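(* Let $n\ge1$ and let $\sum_{\overline N}$ be an $n$-solenoid. Then $\sum_{\overline N}$ is topologically isomorphic with a product of $n$ $1$-solenoids if and only if its character group $\widehat{\sum_{\overline N}}$ is isomorphic with a countable subgroup $G$ of $(\mathbb R,+)$ (in the discrete topology) which has a set of generators $\mathcal S=\{\lambda_i\}$, with canonical representations $\lambda_i=\frac{c^i_1}{d^i_1}\beta_1+\cdots+\frac{c^i_n}{d^i_n}\beta_n$, that is relatively prime with respect to a $\mathbb Q$-basis $B=\{\beta_1,\dots,\beta_n\}\subset G$ of $G$.
   Context: $S^1=\mathbb R/\mathbb Z$, $\mathbf T^n=\prod_{i=1}^nS^1$, $p^n:\mathbb R^n\to\mathbf T^n$ is coordinatewise reduction mod $1$. For a sequence $\overline M=(M_1,M_2,\dots)$ of $n\times n$ integer matrices with non-zero determinants, the $n$-solenoid $\sum_{\overline M}$ is the topological group $\{(\mathbf x^j)_{j\ge1}\in\prod_{j=1}^\infty\mathbf T^n:\mathbf x^j=f_j^{j+1}(\mathbf x^{j+1})\ \forall j\}$, where $f_j^{j+1}:\mathbf T^n\to\mathbf T^n$ satisfies $f_j^{j+1}\circ p^n=p^n\circ M_j$ (so $1$-solenoids correspond to sequences of non-zero integers, with $\pm1$ allowed). The character group of a compact abelian group is its Pontryagin dual. A $\mathbb Q$-basis of a subgroup $G\subset(\mathbb R,+)$ is a set $B=\{\beta_i\}_{i\in I}$ such that every $g\in G-\{0\}$ can be uniquely represented as $g=\frac{c_1}{d_1}\beta_{i_1}+\cdots+\frac{c_m}{d_m}\beta_{i_m}$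 with $\frac{c_l}{d_l}\in\mathbb Q-\{0\}$ and $\gcd(c_l,d_l)=1$. The representation $g=\sum_{i\in I}\frac{c_i}{d_i}\beta_i$, with all fractions in lowest terms and with $\frac{c_i}{d_i}=\frac01$ for all zero terms, is the canonical representation of $g$. A set of generators $\mathcal S$ of $G\subset(\mathbb R,+)$ is relatively prime with respect to the $\mathbb Q$-basis $\{\beta_1,\dots,\beta_n\}$ if for each $\lambda\in\mathcal S$ with canonical representation $\lambda=\frac{c_1}{d_1}\beta_1+\cdots+\frac{c_n}{d_n}\beta_n$ we have $\gcd\big(d_j,\frac d{d_j}\big)=1$ for $j=1,\dots,n$, where $d=d_1\cdots d_n$. *)

(* Defs.v *)
From HB Require Import structures.
From mathcomp Require Import all_boot all_order all_algebra.
From mathcomp Require Import archimedean generic_quotient ring_quotient.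
From mathcomp Require Import all_classical all_reals topology normedtype.

Set Implicit Arguments.
Unset Strict Implicit.
Unset Printing Implicit Defensive.

Import Order.TTheory GRing.Theory Num.Theory.
Import numFieldTopology.Exports numFieldNormedType.Exports.
Local Open Scope classical_set_scope.
Local Open Scope quotient_scope.
Local Open Scope ring_scope.

Section ProductGroup.
Variables (I : Type) (G : I -> zmodType).
Implicit Types x y : prod_topology G.

Let add x y : prod_topology G := fun i => x i + y i.
Let opp x : prod_topology G := fun i => - x i.
Let zero : prod_topology G := fun i => 0.

Let addA : associative add.
Proof.
by move=> x y z; apply: functional_extensionality_dep => i; exact: addrA.
Qed.
Let addC : commutative add.
Proof.
by move=> x y; apply: functional_extensionality_dep => i; exact: addrC.
Qed.
Let add0 : left_id zero add.
Proof.
by move=> x; apply: functional_extensionality_dep => i; exact: add0r.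
Qed.
Let addN : left_inverse zero opp add.
Proof.
by move=> x; apply: functional_extensionality_dep => i; exact: addNr.
Qed.

HB.instance Definition _ := Choice.on (prod_topology G).
HB.instance Definition _ :=
  GRing.isZmodule.Build (prod_topology G) addA addC add0 addN.
End ProductGroup.

HB.instance Definition _ (I : Type) (G : I -> PreTopologicalZmodule.type) :=
  Topological.on (prod_topology G).

Lemma continuous_prod_topology (I : Type) (T : topologicalType)
    (U : I -> topologicalType) (f : T -> prod_topology U) :
  (forall i, continuous (fun x => f x i)) -> continuous f.
Proof.
move=> fc x; apply/cvg_sup => i A [_ [[B oB <-] Bfx BA]].
apply: filterS BA _; apply: (fc i x); exact: open_nbhs_nbhs.
Qed.

Lemma prod_topology_proj_continuous (I : Type) (U : I -> topologicalType)
    (i : I) : continuous (fun x : prod_topology U => x i).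
Proof. exact: (@proj_continuous {classic I} U i). Qed.

Section ProductTopologicalGroup.
Variables (I : Type) (G : I -> topologicalZmodType).

Let sub_continuous :
  continuous (fun x : prod_topology G * prod_topology G => x.1 - x.2).
Proof.
apply: continuous_prod_topology => i x.
apply: (@continuous_comp _ _ _
  (fun x : prod_topology G * prod_topology G => (x.1 i, x.2 i))
  (fun x : G i * G i => x.1 - x.2)); last exact: sub_continuous.
apply: cvg_pair => /=.
  apply: (@continuous_comp _ _ _ fst (fun y : prod_topology G => y i)).
    exact: cvg_fst.
  exact: prod_topology_proj_continuous.
apply: (@continuous_comp _ _ _ snd (fun y : prod_topology G => y i)).
  exact: cvg_snd.
exact: prod_topology_proj_continuous.
Qed.

HB.instance Definition _ :=
  PreTopologicalNmodule_isTopologicalZmodule.Build (prod_topology G)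
    sub_continuous.
End ProductTopologicalGroup.

Definition subgroup (G : zmodType) (H : zmodClosed G) : Type :=
  {x : G | x \in H}.

Section Subgroup.
Variables (G : zmodType) (H : zmodClosed G).
HB.instance Definition _ := [isSub of subgroup H for @sval G _].
HB.instance Definition _ := [Choice of subgroup H by <:].
HB.instance Definition _ := [SubChoice_isSubZmodule of subgroup H by <:].
End Subgroup.

Section SubgroupTopology.
Variables (G : PreTopologicalZmodule.type) (H : zmodClosed G).
HB.instance Definition _ :=
  Topological.copy (subgroup H) (initial_topology (\val : subgroup H -> G)).
End SubgroupTopology.

Section SubgroupTopologicalGroup.
Variables (G : topologicalZmodType) (H : zmodClosed G).

Let sub_continuous :
  continuous (fun x : subgroup H * subgroup H => x.1 - x.2).
Proof.
have vc : continuous (\val : subgroup H -> G) by exact: initial_continuous.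
apply: continuous_comp_initial => x.
apply: (@continuous_comp _ _ _
  (fun x : subgroup H * subgroup H => (\val x.1, \val x.2))
  (fun x : G * G => x.1 - x.2)); last exact: sub_continuous.
apply: cvg_pair => /=.
  by apply: (@continuous_comp _ _ _ fst (\val : subgroup H -> G));
    [exact: cvg_fst|exact: vc].
by apply: (@continuous_comp _ _ _ snd (\val : subgroup H -> G));
    [exact: cvg_snd|exact: vc].
Qed.

HB.instance Definition _ :=
  PreTopologicalNmodule_isTopologicalZmodule.Build (subgroup H) sub_continuous.
End SubgroupTopologicalGroup.

Definition topologically_isomorphic (G H : PreTopologicalZmodule.type) : Prop :=
  exists f : G -> H, exists g : H -> G,
    [/\ {morph f : x y / x + y}, cancel f g, cancel g f,
        continuous f & continuous g].

Section Circle.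
Variable R : realType.

Definition integers : {pred R} := [pred x | x \is a Num.int].

Let integers_zmod_closed : zmod_closed integers.
Proof. by split=> [|x y]; [exact: rpred0|exact: rpredB]. Qed.

HB.instance Definition _ := GRing.isZmodClosed.Build R integers
  integers_zmod_closed.

Definition circle : Type := quotient_topology (Quotient.quot integers).

HB.instance Definition _ := Topological.on circle.
HB.instance Definition _ := Quotient.on circle.
HB.instance Definition _ := GRing.isZmodule.Build circle
  (@Quotient.addqA _ integers) (@Quotient.addqC _ integers)
  (@Quotient.add0q _ integers) (@Quotient.addNq _ integers).

Definition circle_proj (t : R) : circle := \pi_circle t.

Lemma circle_projE s t :
  circle_proj s = circle_proj t <-> s - t \is a Num.int.
Proof.
have := @Quotient.idealrBE _ integers s t.
rewrite inE => ->; split=> [h|/eqP//]; exact/eqP.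
Qed.

Lemma circle_proj_surj (x : circle) : exists t, circle_proj t = x.
Proof. by exists (repr x); exact: reprK. Qed.

Lemma circle_projD : {morph circle_proj : s t / s + t}.
Proof. exact: (@Quotient.pi_add _ integers). Qed.

Lemma circle_projN : {morph circle_proj : t / - t}.
Proof. exact: (@Quotient.pi_opp _ integers). Qed.

Lemma circle_projB : {morph circle_proj : s t / s - t}.
Proof. by move=> s t; rewrite circle_projD circle_projN. Qed.

Lemma circle_proj_continuous : continuous circle_proj.
Proof. exact: (@pi_continuous R (Quotient.quot integers)). Qed.

Lemma circle_proj_nbhs t (A : set R) :
  nbhs t A -> nbhs (circle_proj t) (circle_proj @` A).
Proof.
rewrite nbhsE => -[B [oB Bt] BA].
apply: (@filterS _ _ _ (circle_proj @` B)); first exact: image_subset.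
apply: open_nbhs_nbhs; split; last by exists t.
rewrite /open/= /quotient_open.
rewrite (_ : _ @^-1` _ =
  \bigcup_(k in [set k : R | k \is a Num.int]) ((fun s => s - k) @^-1` B)).
  apply: bigcup_open => k _; apply: open_comp => // s _.
  by apply: cvgB; [exact: cvg_id|exact: cvg_cst].
apply/seteqP; split => [s [u Bu /circle_projE us]|s [k /= k_int Bsk]].
  exists (s - u); first by rewrite /= -opprB rpredN.
  by rewrite /= opprB addrC subrK.
by exists (s - k) => //; apply/circle_projE; rewrite addrAC subrr add0r rpredN.
Qed.

Let sub_continuous : continuous (fun x : circle * circle => x.1 - x.2).
Proof.
move=> [x y]; have [s <-] := circle_proj_surj x.
have [t <-] := circle_proj_surj y => U /=.
rewrite -circle_projB => /circle_proj_continuous.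
have /(_ (s, t)) := @sub_continuous R.
move=> /[apply] -[[A B] /= [sA tB] ABU].
exists (circle_proj @` A, circle_proj @` B).
  by split; exact: circle_proj_nbhs.
move=> [_ _] /= [[a Aa <-] [b Bb <-]].
by rewrite -circle_projB; exact: (ABU (a, b)).
Qed.

HB.instance Definition _ :=
  PreTopologicalNmodule_isTopologicalZmodule.Build circle sub_continuous.

Definition torus (n : nat) : Type := prod_topology (fun _ : 'I_n => circle).

HB.instance Definition _ n := TopologicalZmodule.on (torus n).

Definition torus_proj n (v : 'cV[R]_n) : torus n :=
  fun i => circle_proj (v i 0).

(* The map of the torus induced by the action of M on column vectors; see
   [bonding_mapE]. *)
Definition bonding_map n (M : 'M[int]_n) (x : torus n) : torus n :=
  fun i => \sum_(k < n) x k *~ M i k.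

Lemma bonding_mapE n (M : 'M[int]_n) (v : 'cV[R]_n) :
  bonding_map M (torus_proj v) = torus_proj (map_mx intr M *m v).
Proof.
apply/funext => i; rewrite /bonding_map /torus_proj mxE.
have circle_proj0 : circle_proj 0 = 0.
  by rewrite -(subrr 0) circle_projB subrr.
have circle_projMz t m : circle_proj (m%:~R * t) = circle_proj t *~ m.
  have nat_case k : circle_proj (k%:R * t) = circle_proj t *+ k.
    by elim: k => [|k IHk];
      rewrite ?mul0r// -natr1 mulrDl mul1r circle_projD IHk mulrSr.
  by case: m => k; rewrite ?NegzE ?mulrNz ?mulNr ?circle_projN nat_case.
rewrite (big_morph circle_proj circle_projD circle_proj0).
by apply: eq_bigr => k _; rewrite mxE circle_projMz.
Qed.

Lemma bonding_mapB n (M : 'M[int]_n) :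
  {morph bonding_map M : x y / x - y}.
Proof.
move=> x y; apply/funext => i.
rewrite /bonding_map -[RHS]sumrB.
by apply: eq_bigr => k _; rewrite -mulrzBl.
Qed.

(* Sequences start at 0: [N j] maps coordinate [j.+1] to coordinate [j]. *)
Definition solenoid_pred n (N : nat -> 'M[int]_n) :
    {pred prod_topology (fun _ : nat => torus n)} :=
  [pred x | `[< forall j, x j = bonding_map (N j) (x j.+1) >]].

Let solenoid_zmod_closed n (N : nat -> 'M[int]_n) :
  zmod_closed (solenoid_pred N).
Proof.
have B x y : x \in solenoid_pred N -> y \in solenoid_pred N ->
    x - y \in solenoid_pred N.
  move=> /asboolP xN /asboolP yN; apply/asboolP => j.
  by rewrite -[LHS]/(x j - y j) xN yN -bonding_mapB.
split=> //; apply/asboolP => j; apply/funext => i.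
by rewrite /bonding_map big1// => k _; exact: mul0rz.
Qed.

HB.instance Definition _ n (N : nat -> 'M[int]_n) :=
  GRing.isZmodClosed.Build _ (solenoid_pred N) (solenoid_zmod_closed N).

Definition solenoid n (N : nat -> 'M[int]_n) : Type :=
  subgroup (solenoid_pred N).

HB.instance Definition _ n (N : nat -> 'M[int]_n) :=
  TopologicalZmodule.on (solenoid N).

End Circle.

Section CompactOpenGroup.
Variables (T : topologicalType) (G : PreTopologicalZmodule.type).

HB.instance Definition _ :=
  GRing.Zmodule.copy {compact-open, T -> G} (T -> G).
End CompactOpenGroup.

Section CharacterGroup.
Variables (R : realType) (G : PreTopologicalZmodule.type).

(* The topology of the character group is induced from the compact-open
   topology on all maps. *)
Definition is_character : {pred {compact-open, G -> circle R}} :=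
  [pred chi | `[< {morph chi : x y / x + y} /\ continuous chi >]].

Let is_character_zmod_closed : zmod_closed is_character.
Proof.
split=> [|f g].
  apply/asboolP; split.
    by move=> x y; exact: (esym (addr0 (0 : circle R))).
  exact: (@cst_continuous _ _ (0 : circle R)).
move=> /asboolP[fD fc] /asboolP[gD gc]; apply/asboolP; split.
  move=> x y; rewrite -[LHS]/(f (x + y) - g (x + y)) fD gD.
  by rewrite opprD addrACA.
move=> x; apply: (@continuous_comp _ _ _ (fun x => (f x, g x))
  (fun x : circle R * circle R => x.1 - x.2)); last exact: sub_continuous.
exact: (@cvg_pair G (circle R) (circle R) (nbhs x) (nbhs (f x : circle R))
  (nbhs (g x : circle R)) _ _ _ f g (fc x) (gc x)).
Qed.

HB.instance Definition _ :=
  GRing.isZmodClosed.Build _ is_character is_character_zmod_closed.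

Definition character_group : Type := subgroup is_character.

HB.instance Definition _ := PreTopologicalZmodule.on character_group.

End CharacterGroup.

Definition discrete_group (A : zmodType) (G : zmodClosed A) : Type :=
  discrete_topology (subgroup G).

HB.instance Definition _ (A : zmodType) (G : zmodClosed A) :=
  Topological.on (discrete_group G).
HB.instance Definition _ (A : zmodType) (G : zmodClosed A) :=
  GRing.Zmodule.copy (discrete_group G) (subgroup G).

Section RelativelyPrime.
Variables (R : realType) (n : nat).
Implicit Types (G : zmodClosed R) (S : set R) (b : 'I_n -> R).

(* Zero coefficients are allowed, so that a representation with finitely many
   nonzero terms is a single function on the whole index set. *)
Definition represents b (q : 'I_n -> rat) (g : R) : Prop :=
  g = \sum_(i < n) ratr (q i) * b i.

Definition Qbasis G b : Prop :=
  forall g, g \in G -> g != 0 -> exists! q, represents b q g.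

Definition generates G S : Prop :=
  (forall g, S g -> g \in G) /\
  forall H : zmodClosed R,
    (forall g, S g -> g \in H) -> forall g, g \in G -> g \in H.

(* [denq] is the positive denominator in lowest terms, with [denq 0 = 1]. *)
Definition relatively_prime S b : Prop :=
  forall g q, S g -> represents b q g ->
  forall j, let d k := `|denq (q k)|%N in
    gcdn (d j) ((\prod_(k < n) d k) %/ d j) = 1%N.

End RelativelyPrime.

(* Main.v *)
Require Import Defs.
From HB Require Import structures.
From mathcomp Require Import all_boot all_order all_algebra archimedean.
From mathcomp Require Import all_classical all_reals topology normedtype.
From mathcomp Require Import lebesgue_measure.
From mathcomp Require Import ring lra.

Set Implicit Arguments.
Unset Strict Implicit.
Unset Printing Implicit Defensive.

Import Order.TTheory GRing.Theory Num.Theory.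
Import numFieldTopology.Exports numFieldNormedType.Exports.
Local Open Scope classical_set_scope.
Local Open Scope ring_scope.

(** Write [P_j] for the product of the first [j] bonding matrices, and let [A]
    be the group of the rational row vectors [a] such that [a P_j] is integral
    for some [j]. It is an increasing union of lattices, and it pairs with the
    solenoid: when [a P_j] is the integer vector [z], the pairing of [a] with
    [x] is the sum of the [z_k x_j(k)], whatever the choice of [j]. All of
    the duality theory that is needed is contained in two facts.

    - Every continuous character of the solenoid is the pairing with exactly one
      [a] in [A] ([character_is_pairing], [pairing_inj]). The flow
      [v |-> (P_j^-1 v mod 1)_j] of real n-space into the solenoid turns a
      character into an exponential [v |-> alpha v mod 1]. The circle has no
      small subgroups, so the character kills the kernel of some coordinate [j];
      this makes [alpha P_j] integral, so that [alpha] is in [A].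
    - Every homomorphism from [A] to the circle is the pairing with exactly one
      point of the solenoid ([solenoid_point], [solenoid_separated]): its values
      on the bases of the lattices are the coordinates of the point.

    So the character group of a solenoid is [A]
    ([rational_dual_character_group]), and it is discrete because the solenoid
    is compact ([character_group_discrete]); conversely, solenoids with
    isomorphic abstract groups [A] are topologically isomorphic
    ([solenoid_isomorphic_of_dual]). A product of 1-solenoids is the solenoid of
    diagonal matrices, whose group [A] is a product of [n] subgroups of the
    rationals that contain 1. What remains is algebra.

    - From left to right, choose [n] reals that are linearly independent over
      the rationals and send [a] to the combination with coefficients [a]. The
      one-term combinations generate the image, and they are relatively prime
      since at most one of their denominators differs from 1.
    - From right to left, if the denominators [d_1], ..., [d_n] of a generator
      are pairwise coprime, multiplying it by the product of the [d_k] with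
      [k != j] makes all its terms but the [j]-th integral; since [d_j] is
      coprime to that product, the [j]-th term itself is in the group. Hence the
      group is the direct sum of its intersections with the lines spanned by
      the basis ([relatively_prime_split]), and each summand, as a subgroup of
      the rationals containing 1, is the group [A] of a 1-solenoid
      ([rational_subgroup_denominators]). *)

(** * Additive and continuous maps *)

Lemma morphD_morphB (U V : zmodType) (f : U -> V) :
  {morph f : x y / x + y} -> {morph f : x y / x - y}.
Proof. by move=> fD x y; apply/eqP; rewrite eq_sym subr_eq -fD subrK. Qed.

Definition additive_of (U V : zmodType) (f : U -> V)
    (fD : {morph f : x y / x + y}) : {additive U -> V} :=
  HB.pack f (GRing.isZmodMorphism.Build U V f (morphD_morphB fD)).

Definition group_isomorphic (U V : zmodType) : Prop :=
  exists f : {additive U -> V}, bijective f.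

Lemma group_isomorphic_sym (U V : zmodType) :
  group_isomorphic U V -> group_isomorphic V U.
Proof.
move=> [f [g fK gK]].
have gD : {morph g : x y / x + y}.
  by move=> x y; apply: (can_inj fK); rewrite raddfD /= !gK.
by exists (additive_of gD); exists f.
Qed.

Lemma group_isomorphic_trans (V U W : zmodType) :
  group_isomorphic U V -> group_isomorphic V W -> group_isomorphic U W.
Proof.
move=> [f fbij] [g gbij].
by exists (g \o f : {additive U -> W}); exact: bij_comp.
Qed.

Section ContinuousSums.
Variables (T : topologicalType) (G : topologicalZmodType).

Lemma continuous_sub (f g : T -> G) :
  continuous f -> continuous g -> continuous (fun z => f z - g z).
Proof.
move=> fc gc z; apply: (@continuous_comp _ _ _ (fun z => (f z, g z))
  (fun x : G * G => x.1 - x.2)); last exact: sub_continuous.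
exact: (@cvg_pair T G G (nbhs z) (nbhs (f z)) (nbhs (g z)) _ _ _ f g
  (fc z) (gc z)).
Qed.

Lemma continuous_mulrn (f : T -> G) m :
  continuous f -> continuous (fun z => f z *+ m).
Proof.
move=> fc.
have -> : (fun z => f z *+ m) = (fun z => \sum_(i < m) f z).
  by apply/funext => z; rewrite sumr_const card_ord.
apply: continuous_big => [|i _]; [exact: add_continuous|exact: fc].
Qed.

Lemma continuous_mulrz (f : T -> G) (m : int) :
  continuous f -> continuous (fun z => f z *~ m).
Proof.
move=> fc; case: m => m; first exact: continuous_mulrn.
have -> : (fun z => f z *~ Negz m) = (fun z => 0 - f z *+ m.+1).
  by apply/funext => z; rewrite sub0r NegzE mulrNz.
apply: continuous_sub; first exact: cst_continuous.
exact: continuous_mulrn.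
Qed.

End ContinuousSums.

Lemma cvg_initial (S : choiceType) (T : topologicalType) (f : S -> T)
    (F : set_system S) (s : initial_topology f) :
  Filter F -> f @ F --> f s -> F --> s.
Proof.
move=> FF Fs A; rewrite nbhsE => -[_ [[B oB <-] Bs] BA].
by apply: filterS BA _; apply: Fs; exact: open_nbhs_nbhs.
Qed.

Lemma cvg_prod_topology (I : Type) (U : I -> topologicalType)
    (F : set_system (prod_topology U)) (y : prod_topology U) :
  Filter F -> (forall i, x i @[x --> F] --> y i) -> F --> y.
Proof.
move=> FF Fy; apply/cvg_sup => i A [_ [[B oB <-] By BA]].
by apply: filterS BA _; apply: (Fy i); exact: open_nbhs_nbhs.
Qed.

(** * The circle *)

Section Circle.
Variable R : realType.
Implicit Types (s t u a b : R) (x y : circle R).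

HB.instance Definition _ :=
  GRing.isZmodMorphism.Build R (circle R) (@circle_proj R) (@circle_projB R).

(** A quarter turn on each side of zero: short enough that doubling an element
    of the arc cannot wrap around the circle. *)
Definition small_arc : set (circle R) :=
  @circle_proj R @` [set t | `|t| < 1 / 4].

Lemma small_arc_nbhs : nbhs (0 : circle R) small_arc.
Proof.
rewrite -(raddf0 (@circle_proj R)); apply: circle_proj_nbhs.
apply/nbhs_ballP; exists (1 / 4) => /=; first by lra.
by move=> t; rewrite /ball /= sub0r normrN.
Qed.

Lemma circle_proj_inj_near s t :
  `|s - t| < 1 -> circle_proj s = circle_proj t -> s = t.
Proof.
move=> st1 /circle_projE st_int; apply/eqP; rewrite -subr_eq0.
by apply: contraTT st1 => st0; rewrite -leNgt norm_intr_ge1.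
Qed.

Lemma circle_projBz t (m : int) : circle_proj (t - m%:~R) = circle_proj t.
Proof.
by apply/circle_projE; rewrite addrAC subrr add0r rpredN intr_int.
Qed.

Lemma circle_lift a x : exists2 t, a <= t < a + 1 & circle_proj t = x.
Proof.
have [t <-] := circle_proj_surj x.
exists (t - (Num.floor (t - a))%:~R); last exact: circle_projBz.
by have := floor_itv (t - a); rewrite intrD => /andP[]; lra.
Qed.

Lemma circle_half_unique s t :
  `|s| < 1 / 4 -> `|t| < 1 / 4 ->
  circle_proj t *+ 2 = circle_proj s -> t *+ 2 = s.
Proof.
move=> s4 t4; rewrite -(raddfMn (@circle_proj R)) /=.
apply: circle_proj_inj_near.
by move: s4 t4; rewrite !ltr_norml mulr2n; lra.
Qed.

(** If all multiples of [x] are small, then doubling never wraps around, so the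
    small representative of [x] can be doubled for ever and stays bounded. *)
Lemma no_small_subgroup x : (forall m, small_arc (x *+ m)) -> x = 0.
Proof.
move=> xsmall; have [t /= t4 tx] := xsmall 1%N.
rewrite mulr1n in tx.
have pow k : `|t *+ 2 ^ k| < 1 / 4.
  elim: k => [|k IHk]; first by rewrite mulr1n.
  have [s /= s4] := xsmall (2 ^ k.+1)%N.
  by rewrite -tx -raddfMn expnSr mulrnA raddfMn => /esym/circle_half_unique ->.
suff t0 : t = 0 by rewrite -tx t0 raddf0.
apply/eqP; apply: contraT; rewrite -normr_gt0 => t_gt0.
have /archi_boundP : 0 <= `|t|^-1 by rewrite invr_ge0.
set k := Num.Def.archi_bound _ => tk; move: (pow k).
rewrite normrMn -mulr_natr ltNge => /negP[].
have : 1 < `|t| * k%:R by rewrite mulrC -ltr_pdivrMr// div1r.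
have : `|t| * k%:R <= `|t| * (2 ^ k)%:R.
  by rewrite ler_wpM2l// ler_nat ltnW// ltn_expl.
by lra.
Qed.

(** Every real is a multiple of [d k] plus a remainder smaller than [d k], so
    the values of [g] on all reals are as small as its values near zero; they
    form a subgroup, which must be trivial. *)
Lemma circle_hom_vanish (g : {additive R -> circle R}) (d : nat -> R) :
  continuous g -> (forall e, 0 < e -> exists k, 0 < d k < e) ->
  (forall k, g (d k) = 0) -> forall t, g t = 0.
Proof.
move=> gc dsmall gd t; apply: no_small_subgroup => m.
rewrite -raddfMn /=; move: (t *+ m) => {m t} s.
have : nbhs (0 : R) (g @^-1` small_arc).
  by apply: gc; rewrite raddf0; exact: small_arc_nbhs.
move=> /nbhs_ballP[e /= e_gt0 eg].
have [k /andP[dk_gt0 dke]] := dsmall _ e_gt0.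
have -> : s = (s - d k *~ Num.floor (s / d k)) + d k *~ Num.floor (s / d k).
  by rewrite subrK.
rewrite raddfD /= (raddfMz g) gd mul0rz addr0; apply: eg.
rewrite /ball /= sub0r normrN ltr_norml.
have /andP[] := floor_itv (s / d k).
rewrite intrD ler_pdivlMr// ltr_pdivrMr// -mulrzr => lo hi.
by apply/andP; split; lra.
Qed.

(** The slope is read off on one small number [d 0]. On its successive halves
    [d k] the value of [f] is forced, because a small element of the circle has
    a single small half, and the [d k] determine [f]. *)
Lemma character_of_R (f : {additive R -> circle R}) :
  continuous f -> exists a, forall t, f t = circle_proj (a * t).
Proof.
move=> fc.
have : nbhs (0 : R) (f @^-1` small_arc).
  by apply: fc; rewrite raddf0; exact: small_arc_nbhs.
move=> /nbhs_ballP[e /= e_gt0 ef].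
pose d k := e / 2 / 2 ^+ k.
have d_gt0 k : 0 < d k by rewrite !divr_gt0// exprn_gt0.
have dS k : d k.+1 *+ 2 = d k.
  by rewrite /d exprS -mulr_natr; field; rewrite expf_neq0 ?pnatr_eq0.
have d0 : d 0 < e by rewrite /d expr0 divr1; lra.
have d_dec k : d k.+1 <= d k by rewrite -(dS k) mulr2n lerDl ltW.
have d_small k : d k < e by elim: k => // k; apply: le_lt_trans.
have fd k : small_arc (f (d k)).
  by apply: ef; rewrite /ball /= sub0r normrN gtr0_norm.
have [c c4 cd0] := fd 0%N.
pose a := c / d 0.
have ad4 k : `|a * d k| < 1 / 4.
  elim: k => [|k IHk]; first by rewrite divfK// gt_eqF.
  apply: le_lt_trans IHk; rewrite [leLHS]normrM [leRHS]normrM ler_wpM2l//.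
  by rewrite !(gtr0_norm (d_gt0 _)).
have fad k : f (d k) = circle_proj (a * d k).
  elim: k => [|k IHk]; first by rewrite divfK ?gt_eqF.
  have [u u4 uf] := fd k.+1.
  have : circle_proj u *+ 2 = circle_proj (a * d k).
    by rewrite uf -raddfMn /= dS.
  move=> /circle_half_unique -/(_ (ad4 k) u4) ua.
  rewrite -uf; congr circle_proj.
  by move: ua; rewrite -(dS k) !mulr2n mulrDr; lra.
exists a => t; apply/eqP; rewrite -subr_eq0; apply/eqP.
pose g (t : R) := f t - circle_proj (a * t).
have gD : {morph g : x y / x + y}.
  by move=> x y; rewrite /g raddfD mulrDr raddfD /= opprD addrACA.
have gc : continuous g.
  apply: continuous_sub; first exact: fc.
  move=> x; apply: (@continuous_comp _ _ _ (fun z : R => a * z)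
    (@circle_proj R)); last exact: circle_proj_continuous.
  exact: mulrl_continuous.
apply: (@circle_hom_vanish (additive_of gD) d) => // [e' e'_gt0|k] /=.
- have [k ke] : exists k, e / e' < k%:R.
    exists (Num.Def.archi_bound (e / e')).
    by rewrite archi_boundP// divr_ge0 ?ltW.
  exists k; rewrite d_gt0/= /d ltr_pdivrMr ?exprn_gt0//.
  have : e / 2 < e' * k%:R.
    by rewrite mulrC; rewrite ltr_pdivrMr// in ke; lra.
  move=> /lt_le_trans; apply; rewrite ler_pM2l// -natrX ler_nat ltnW//.
  exact: ltn_expl.
- by rewrite /g fad subrr.
Qed.

Lemma open_arc a b : open (@circle_proj R @` `]a, b[).
Proof.
rewrite openE => _ [t tI <-].
by apply: circle_proj_nbhs; apply: open_nbhs_nbhs; split => //; exact: itv_open.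
Qed.

(** The complement of such an arc is the image of an open interval. *)
Lemma closed_arc a b : a <= b -> b < a + 1 ->
  closed (@circle_proj R @` `[a, b]).
Proof.
move=> ab ba1.
have -> : @circle_proj R @` `[a, b] = ~` (@circle_proj R @` `]b, (a + 1)[).
  apply/seteqP; split=> [_ [s /= + <-] [t /= +]|x].
    rewrite !in_itv /= => /andP[as_ sb] /andP[bt ta] ts.
    suff ts' : t = s by lra.
    by apply: circle_proj_inj_near ts; rewrite ltr_norml; lra.
  have [s /andP[lo hi] <-] := circle_lift a x => sb.
  exists s => //=; rewrite in_itv /= lo /= leNgt; apply/negP => bs.
  by apply: sb; exists s => //=; rewrite in_itv /= bs.
by apply: open_closedC; exact: open_arc.
Qed.

Lemma closed_zero : closed [set (0 : circle R)].
Proof.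
suff <- : @circle_proj R @` `[0, 0] = [set 0] by apply: closed_arc; lra.
by rewrite set_itv1 image_set1 raddf0.
Qed.

Lemma compact_circle : compact [set: circle R].
Proof.
have -> : [set: circle R] = @circle_proj R @` `[0, 1].
  apply/seteqP; split=> // x _; have [t /andP[t0 t1] <-] := circle_lift 0 x.
  by exists t => //=; rewrite in_itv /=; apply/andP; split; lra.
apply: continuous_compact; last exact: segment_compact.
by apply: continuous_subspaceT => x; exact: circle_proj_continuous.
Qed.

End Circle.

(** * The rational dual of a solenoid *)

Section RationalDual.
Variables (n : nat) (N : nat -> 'M[int]_n).

Fixpoint partial_product j : 'M[int]_n :=
  if j is i.+1 then partial_product i *m N i else 1%:M.

(** The integral vector is part of the data because the pairing is computed
    from it. *)
Definition integral_at (a : 'rV[rat]_n) j (z : 'rV[int]_n) : Prop :=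
  a *m map_mx intr (partial_product j) = map_mx intr z.

Lemma integral_atS a j z :
  integral_at a j z -> integral_at a j.+1 (z *m N j).
Proof. by rewrite /integral_at /= !map_mxM mulmxA => ->. Qed.

Lemma integral_at_le a i j z : (i <= j)%N ->
  integral_at a i z -> exists z', integral_at a j z'.
Proof.
move=> /subnK <-; elim: (j - i)%N => [|k IHk] az; first by exists z.
by have [z' az'] := IHk az; exists (z' *m N (k + i)); exact: integral_atS.
Qed.

Lemma integral_at_unique a j z z' :
  integral_at a j z -> integral_at a j z' -> z = z'.
Proof.
rewrite /integral_at => -> /matrixP zz'; apply/matrixP => i k.
by have := zz' i k; rewrite !mxE => /intr_inj.
Qed.

Lemma integral_atB a b j y z :
  integral_at a j y -> integral_at b j z -> integral_at (a - b) j (y - z).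
Proof. by rewrite /integral_at mulmxBl => -> ->; rewrite map_mxB. Qed.

Definition rational_dual_pred : {pred 'rV[rat]_n} :=
  [pred a | `[< exists j z, integral_at a j z >]].

Lemma rational_dualP a :
  reflect (exists j z, integral_at a j z) (a \in rational_dual_pred).
Proof. exact: asboolP. Qed.

Lemma common_integral_at a b :
  a \in rational_dual_pred -> b \in rational_dual_pred ->
  exists j y z, integral_at a j y /\ integral_at b j z.
Proof.
move=> /rational_dualP[i [y ay]] /rational_dualP[j [z bz]].
have [y' ay'] := integral_at_le (leq_maxl i j) ay.
have [z' bz'] := integral_at_le (leq_maxr i j) bz.
by exists (maxn i j), y', z'.
Qed.

Let rational_dual_zmod_closed : zmod_closed rational_dual_pred.
Proof.
split=> [|a b aD bD]; apply/rational_dualP.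
  by exists 0%N, 0; rewrite /integral_at mul0mx raddf0.
have [j [y [z [ay bz]]]] := common_integral_at aD bD.
by exists j, (y - z); exact: integral_atB.
Qed.

HB.instance Definition _ :=
  GRing.isZmodClosed.Build _ rational_dual_pred rational_dual_zmod_closed.

(** For nonsingular bonding matrices this increasing union of lattices is the
    character group of the solenoid: see [rational_dual_character_group]. *)
Definition rational_dual : zmodType := subgroup rational_dual_pred.

Lemma rational_dual_witness (a : rational_dual) :
  exists jz : nat * 'rV[int]_n, integral_at (val a) jz.1 jz.2.
Proof. by have /rational_dualP[j [z az]] := valP a; exists (j, z). Qed.

Hypothesis detN : forall j, \det (N j) != 0.

Lemma partial_product_unit (F : numFieldType) j :
  (map_mx intr (partial_product j) : 'M[F]_n) \in unitmx.
Proof.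
rewrite unitmxE unitfE det_map_mx intr_eq0.
by elim: j => [|j IHj] /=; rewrite ?det1// det_mulmx mulf_neq0.
Qed.

(** The [k]-th vector of a basis of the [j]-th lattice: its pairing with a point
    of the solenoid is coordinate [k] of level [j]. *)
Definition dual_basis_vector j k : 'rV[rat]_n :=
  delta_mx 0 k *m invmx (map_mx intr (partial_product j)).

Lemma dual_basis_vector_integral j k :
  integral_at (dual_basis_vector j k) j (delta_mx 0 k).
Proof.
by rewrite /integral_at mulmxKV ?partial_product_unit// map_delta_mx.
Qed.

Lemma dual_basis_vector_in j k :
  dual_basis_vector j k \in rational_dual_pred.
Proof.
apply/rational_dualP; exists j, (delta_mx 0 k).
exact: dual_basis_vector_integral.
Qed.

Definition dual_basis j k : rational_dual :=
  exist _ (dual_basis_vector j k) (dual_basis_vector_in j k).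

Lemma dual_basis_decomp (a : rational_dual) j z :
  integral_at (val a) j z -> a = \sum_k dual_basis j k *~ z 0 k.
Proof.
move=> az; apply: val_inj; rewrite raddf_sum.
rewrite -[LHS](mulmxK (partial_product_unit _ j)) az.
rewrite [map_mx _ _]row_sum_delta mulmx_suml; apply: eq_bigr => k _.
by rewrite mxE -scalemxAl raddfMz scaler_int.
Qed.

(** This mirrors the equation of the solenoid: the values on the bases of a
    homomorphism to the circle are the coordinates of a point. *)
Lemma dual_basis_bonding j i :
  \sum_k dual_basis j.+1 k *~ N j i k = dual_basis j i.
Proof.
rewrite (@dual_basis_decomp (dual_basis j i) j.+1 (row i (N j))).
  by apply: eq_bigr => k _; rewrite mxE.
by rewrite rowE; apply: integral_atS; exact: dual_basis_vector_integral.
Qed.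

End RationalDual.

(** * The pairing of a solenoid with its rational dual *)

Section TorusSequences.
Variables (R : realType) (n : nat).

Definition torus_sequences := prod_topology (fun _ : nat => torus R n).

Lemma torus_sequences_coordinate_continuous j k :
  continuous (fun x : torus_sequences => x j k).
Proof.
move=> x; apply: (@continuous_comp torus_sequences (torus R n) (circle R)
  (fun x : torus_sequences => x j) (fun t : torus R n => t k)).
  exact: (@prod_topology_proj_continuous nat (fun=> torus R n)).
exact: (@prod_topology_proj_continuous 'I_n (fun=> circle R)).
Qed.

Lemma cvg_torus_sequences (F : set_system torus_sequences)
    (x : torus_sequences) : Filter F ->
  (forall j k, y j k @[y --> F] --> x j k) -> F --> x.
Proof.
move=> FF Fx; apply: (@cvg_prod_topology nat (fun=> torus R n)) => j.
by apply: (@cvg_prod_topology 'I_n (fun=> circle R)) => k; exact: Fx.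
Qed.

End TorusSequences.

Section Pairing.
Variables (R : realType) (n : nat) (N : nat -> 'M[int]_n).
Implicit Types (x y : solenoid R N) (a b : rational_dual N).

Lemma solenoidE x j i :
  val x j i = \sum_k val x j.+1 k *~ N j i k.
Proof. by have /asboolP/(_ j) := valP x => ->. Qed.

Lemma solenoid_coordinateD j k :
  {morph (fun x : solenoid R N => val x j k) : x y / x + y}.
Proof. by []. Qed.

Definition solenoid_coordinate j k : {additive solenoid R N -> circle R} :=
  additive_of (solenoid_coordinateD j k).

Lemma solenoid_coordinateB j k :
  {morph (fun x : solenoid R N => val x j k) : x y / x - y}.
Proof. exact: (raddfB (solenoid_coordinate j k)). Qed.

Let val_continuous : continuous (\val : solenoid R N -> torus_sequences R n).
Proof.
move=> x A; rewrite nbhsE => -[B [oB Bx] BA].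
suff : nbhs x (\val @^-1` A) by [].
rewrite nbhsE; exists (\val @^-1` B); last by move=> y /BA.
by split=> //; exists B.
Qed.

Lemma solenoid_coordinate_continuous j k :
  continuous (fun x : solenoid R N => val x j k).
Proof.
move=> x; apply: (@continuous_comp (solenoid R N) (torus_sequences R n)
  (circle R) (\val : solenoid R N -> torus_sequences R n)
  (fun y : torus_sequences R n => y j k)).
  exact: val_continuous.
exact: torus_sequences_coordinate_continuous.
Qed.

Lemma cvg_solenoid (F : set_system (solenoid R N)) x : Filter F ->
  (forall j k, val y j k @[y --> F] --> val x j k) -> F --> x.
Proof.
move=> FF Fx; apply: (@cvg_initial _ (torus_sequences R n)).
by apply: cvg_torus_sequences => j k; exact: Fx.
Qed.

Lemma continuous_solenoid (T : topologicalType) (f : T -> solenoid R N) :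
  (forall j k, continuous (fun t => val (f t) j k)) -> continuous f.
Proof. by move=> fc t; apply: cvg_solenoid => j k; exact: fc. Qed.

Definition coordinate_character j (z : 'rV[int]_n) x : circle R :=
  \sum_k val x j k *~ z 0 k.

Lemma coordinate_characterS j z x :
  coordinate_character j z x = coordinate_character j.+1 (z *m N j) x.
Proof.
rewrite /coordinate_character.
under eq_bigr do rewrite solenoidE mulrz_suml.
rewrite exchange_big /=; apply: eq_bigr => k _.
by rewrite mxE mulrz_sumr; apply: eq_bigr => i _; rewrite -mulrzA mulrC.
Qed.

Lemma coordinate_character_eq (a : 'rV_n) i j w z x :
  integral_at N a i w -> integral_at N a j z ->
  coordinate_character i w x = coordinate_character j z x.
Proof.
wlog ij : i j w z / (i <= j)%N => [th aw az|].
  by case/orP: (leq_total i j) => ij; [|symmetry]; apply: th => //.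
rewrite -(subnK ij); move: (j - i)%N => {ij} k aw.
elim: k z => [|k IHk] z az; first by rewrite (integral_at_unique aw az).
have [u au] := integral_at_le (leq_addl k i) aw.
rewrite (IHk _ au) coordinate_characterS.
by rewrite (integral_at_unique (integral_atS au) az).
Qed.

(** Any level at which [val a] becomes integral gives the same value: see
    [pairingE]. *)
Definition pairing a x : circle R :=
  let jz := projT1 (cid (rational_dual_witness a)) in
  coordinate_character jz.1 jz.2 x.

Lemma pairingE a j z x :
  integral_at N (val a) j z -> pairing a x = coordinate_character j z x.
Proof.
rewrite /pairing; case: cid => -[i w] /= aw az.
exact: coordinate_character_eq aw az.
Qed.

Lemma pairingBl a b x : pairing (a - b) x = pairing a x - pairing b x.
Proof.
have [j [w [z [aw bz]]]] := common_integral_at (valP a) (valP b).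
rewrite (pairingE _ aw) (pairingE _ bz).
rewrite (pairingE (a := a - b) _ (integral_atB aw bz)).
rewrite /coordinate_character -sumrB; apply: eq_bigr => k _.
by rewrite !mxE mulrzBr.
Qed.

Lemma pairingDr a : {morph pairing a : x y / x + y}.
Proof.
move=> x y; rewrite /pairing /coordinate_character -big_split /=.
by apply: eq_bigr => k _; rewrite -mulrzDl.
Qed.

Lemma pairing_continuous a : continuous (pairing a).
Proof.
apply: continuous_big => [|k _]; first exact: add_continuous.
by apply: continuous_mulrz; exact: solenoid_coordinate_continuous.
Qed.

End Pairing.

(** * Characters of a solenoid *)

Section Characters.
Variables (R : realType) (n : nat) (N : nat -> 'M[int]_n).
Hypothesis detN : forall j, \det (N j) != 0.

Let P j : 'M[R]_n := map_mx intr (partial_product N j).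

Let P_unit j : P j \in unitmx.
Proof. exact: partial_product_unit. Qed.

(* The one-parameter subgroups of the solenoid: level [j] is [P_j^-1 v] mod 1,
   and level 0 is the covering map of the torus. *)
Let flow_coord (v : 'cV[R]_n) : prod_topology (fun _ : nat => torus R n) :=
  fun j => torus_proj (invmx (P j) *m v).

Let flow_in v : flow_coord v \in solenoid_pred N.
Proof.
apply/asboolP => j; rewrite /flow_coord bonding_mapE; congr torus_proj.
rewrite -[in LHS](mulKVmx (P_unit j.+1) v).
have -> : P j.+1 = P j *m map_mx intr (N j) by rewrite /P /= map_mxM.
by rewrite -mulmxA mulKmx.
Qed.

Definition flow v : solenoid R N := exist _ (flow_coord v) (flow_in v).

Lemma flowE v j : val (flow v) j = torus_proj (invmx (P j) *m v).
Proof. by []. Qed.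

Lemma flowD : {morph flow : v w / v + w}.
Proof.
move=> v w; apply: val_inj; apply/funext => j; apply/funext => k.
by rewrite flowE /torus_proj mulmxDr mxE raddfD.
Qed.

Lemma flow_lineE k (t : R) j i :
  val (flow (t *: delta_mx k 0)) j i = circle_proj (t * invmx (P j) i k).
Proof. by rewrite flowE /torus_proj -scalemxAr mxE -colE mxE. Qed.

Lemma flow_line_continuous k :
  continuous (fun t : R => flow (t *: delta_mx k 0)).
Proof.
apply: continuous_solenoid => j i.
have -> : (fun t : R => val (flow (t *: delta_mx k 0)) j i) =
    fun t => circle_proj (t * invmx (P j) i k).
  by apply/funext => t; exact: flow_lineE.
move=> t; apply: (@continuous_comp _ _ _ (fun t : R => t * (invmx (P j)) i k)
  (@circle_proj R)); last exact: circle_proj_continuous.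
exact: mulrr_continuous.
Qed.

Lemma coordinate_character_flow j z v :
  coordinate_character j z (flow v) =
  circle_proj ((map_mx intr z *m invmx (P j) *m v) 0 0).
Proof.
rewrite /coordinate_character -mulmxA mxE raddf_sum; apply: eq_bigr => k _.
by rewrite flowE /torus_proj -raddfMz [map_mx _ _ 0 k]mxE mulrzl.
Qed.

Lemma pairing_flow (a : rational_dual N) v :
  pairing a (flow v) = circle_proj ((map_mx ratr (val a) *m v) 0 0).
Proof.
have /rational_dualP[j [z az]] := valP a.
rewrite (pairingE _ az) coordinate_character_flow; congr (circle_proj (_ 0 0)).
congr (_ *m _); rewrite -[RHS](mulmxK (P_unit j)); congr (_ *m _).
have := congr1 (map_mx (ratr : rat -> R)) az.
rewrite [LHS]map_mxM -!map_mx_comp => /esym.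
have ratrz : (ratr \o intr : int -> R) =1 intr by move=> m /=; rewrite ratr_int.
by rewrite !(eq_map_mx _ ratrz).
Qed.

Lemma coordinate_zero_le i j (x : solenoid R N) : (i <= j)%N ->
  val x j = 0 -> val x i = 0.
Proof.
move=> /subnK <-; elim: (j - i)%N => [//|k IHk] x0; apply: IHk.
apply/funext => l; rewrite solenoidE big1// => m _.
by rewrite -/(k.+1 + i)%N x0 mul0rz.
Qed.

(** The kernels of the coordinates decrease and shrink to zero, so the character
    maps one of them into the small arc; the image is a subgroup, hence it is
    zero. *)
Lemma character_kernel (chi : {additive solenoid R N -> circle R}) :
  continuous chi -> exists j, forall x : solenoid R N, val x j = 0 -> chi x = 0.
Proof.
move=> chic.
pose K j : set (solenoid R N) := [set x | val x j = 0].
pose F := filter_from [set: nat] K.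
have FF : Filter F.
  apply: filter_from_filter; first by exists 0%N.
  move=> i j _ _; exists (maxn i j) => // x xij.
  by split; apply: coordinate_zero_le xij; rewrite ?leq_maxl ?leq_maxr.
have F0 : F --> (0 : solenoid R N).
  apply: cvg_solenoid => i k; apply: cvg_near_cst.
  by exists i => // x xi0; rewrite xi0.
have [j _ Kj] : F (chi @^-1` @small_arc R).
  by apply: F0; apply: chic; rewrite raddf0; exact: small_arc_nbhs.
exists j => x xj; apply: no_small_subgroup => m.
rewrite -raddfMn; apply: Kj; apply/funext => k.
have := raddfMn (solenoid_coordinate R N j k) m x.
by rewrite [RHS](_ : _ = 0)// /= xj mul0rn.
Qed.

(** Along the flow a character is [v |-> alpha v mod 1]. Take [j] such that it
    kills the kernel of coordinate [j]. The flow sends [P_j w] into this kernel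
    for every integral [w], so [alpha P_j] is integral and [alpha] is in the
    rational dual. Both the character and the pairing with [alpha] depend on
    coordinate [j] only, and the flow takes every value there, so they agree
    everywhere as they agree on the flow. *)
Theorem character_is_pairing (chi : {additive solenoid R N -> circle R}) :
  continuous chi -> exists a, forall x : solenoid R N, chi x = pairing a x.
Proof.
move=> chic; have [j chi0] := character_kernel chic.
have lineD k : {morph (fun t : R => chi (flow (t *: delta_mx k 0))) :
    s t / s + t}.
  by move=> s t; rewrite scalerDl flowD raddfD.
have /choice[alpha alphaE] k : exists a : R,
    forall t, chi (flow (t *: delta_mx k 0)) = circle_proj (a * t).
  apply: (character_of_R (f := additive_of (lineD k))) => t.
  apply: (@continuous_comp _ _ _ (fun t : R => flow (t *: delta_mx k 0)) chi).
    exact: flow_line_continuous.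
  exact: chic.
pose A : 'rV[R]_n := \row_k alpha k.
have flow_sum (I : finType) (F : I -> 'cV[R]_n) :
    flow (\sum_i F i) = \sum_i flow (F i).
  exact: (raddf_sum (additive_of flowD)).
have chi_flow v : chi (flow v) = circle_proj ((A *m v) 0 0).
  have -> : v = \sum_k v k 0 *: delta_mx k 0.
    by rewrite {1}[v]matrix_sum_delta; apply: eq_bigr => k _; rewrite big_ord1.
  rewrite flow_sum mulmx_sumr summxE !raddf_sum; apply: eq_bigr => k _.
  by rewrite alphaE -scalemxAr -colE !mxE mulrC.
have AP_int k : (A *m P j) 0 k \is a Num.int.
  have -> : (A *m P j) 0 k = (A *m (P j *m delta_mx k (0 : 'I_1))) 0 0 - 0.
    by rewrite mulmxA -colE [in RHS]mxE subr0.
  apply/circle_projE; rewrite -chi_flow raddf0 chi0//.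
  rewrite flowE mulKmx//; apply/funext => i; rewrite /torus_proj mxE.
  rewrite -[RHS](raddf0 (@circle_proj R)); apply/circle_projE.
  by rewrite subr0 rpred_nat.
pose z : 'rV[int]_n := \row_k Num.floor ((A *m P j) 0 k).
have zE : map_mx intr z = A *m P j.
  by apply/rowP => k; rewrite [LHS]mxE [z 0 k]mxE floorK// AP_int.
pose a : 'rV[rat]_n :=
  map_mx intr z *m invmx (map_mx intr (partial_product N j)).
have az : integral_at N a j z.
  by rewrite /integral_at mulmxKV ?partial_product_unit.
have aD : a \in rational_dual_pred N by apply/rational_dualP; exists j, z.
pose a' : rational_dual N := exist _ a aD.
have a'z : integral_at N (val a') j z := az.
exists a' => x.
have [t tx] := choice (fun k => circle_proj_surj (val x j k)).
(* the point of the flow with the same coordinate [j] as [x] *)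
pose y := flow (P j *m \col_k t k).
have yx : val y j = val x j.
  by rewrite flowE mulKmx//; apply/funext => k; rewrite /torus_proj mxE.
transitivity (chi y).
  apply/eqP; rewrite -subr_eq0 -raddfB /=; apply/eqP/chi0.
  by apply/funext => k; rewrite solenoid_coordinateB yx subrr.
transitivity (pairing a' y).
  by rewrite (pairingE y a'z) coordinate_character_flow zE mulmxK// chi_flow.
rewrite !(pairingE _ a'z); apply: eq_bigr => k _.
by rewrite yx.
Qed.

(** A nonzero entry [q] of [a - b] is detected on the flow, at parameter
    [1 / (2 q)] along its axis: the value there is half a turn. *)
Lemma pairing_inj (a b : rational_dual N) :
  (forall x, pairing (R := R) a x = pairing b x) -> a = b.
Proof.
move=> ab; apply/eqP; rewrite -subr_eq0; apply/eqP/val_inj.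
move: (a - b) (fun x => pairingBl (R := R) a b x) => {}c c0.
apply/rowP => k; rewrite [RHS]mxE; apply/eqP; apply: contraT => ck.
have rck : ratr (val c 0 k) != 0 :> R by rewrite fmorph_eq0.
pose v : 'cV[R]_n := (2 * ratr (val c 0 k))^-1 *: delta_mx k 0.
have := c0 (flow v); rewrite ab subrr pairing_flow.
have -> : (map_mx ratr (val c) *m v) 0 0 = 1 / 2 :> R.
  by rewrite /v -scalemxAr mxE -colE !mxE; field; rewrite rck.
rewrite -(raddf0 (@circle_proj R)) => /circle_proj_inj_near.
by rewrite /= subr0 ger0_norm; lra.
Qed.

End Characters.

(** * Topological isomorphisms and character groups *)

Lemma topologically_isomorphic_sym (G H : PreTopologicalZmodule.type) :
  topologically_isomorphic G H -> topologically_isomorphic H G.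
Proof.
move=> [f [g [fD fK gK fc gc]]]; exists g, f; split=> // x y.
by apply: (can_inj fK); rewrite fD !gK.
Qed.

Lemma topologically_isomorphic_trans (G H K : PreTopologicalZmodule.type) :
  topologically_isomorphic G H -> topologically_isomorphic H K ->
  topologically_isomorphic G K.
Proof.
move=> [f [f' [fD fK f'K fc f'c]]] [g [g' [gD gK g'K gc g'c]]].
exists (g \o f), (f' \o g'); split.
- by move=> x y; rewrite /= fD gD.
- exact: can_comp.
- exact: can_comp.
- by move=> x; apply: continuous_comp; [exact: fc|exact: gc].
- by move=> x; apply: continuous_comp; [exact: g'c|exact: f'c].
Qed.

Lemma topologically_isomorphic_group (G H : PreTopologicalZmodule.type) :
  topologically_isomorphic G H -> group_isomorphic G H.
Proof. by move=> [f [g [fD fK gK _ _]]]; exists (additive_of fD); exists g. Qed.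

Section CharacterGroup.
Variable R : realType.

Section Characters.
Variable G : PreTopologicalZmodule.type.

Lemma characterP (chi : character_group R G) :
  {morph (val chi : G -> circle R) : x y / x + y} /\
  continuous (val chi : G -> circle R).
Proof. exact/asboolP/(valP chi). Qed.

Lemma is_characterP (f : G -> circle R) :
  {morph f : x y / x + y} -> continuous f ->
  (f : {compact-open, G -> circle R}) \in @is_character R G.
Proof. by move=> fD fc; apply/asboolP. Qed.

Definition character (f : G -> circle R) (fD : {morph f : x y / x + y})
  (fc : continuous f) : character_group R G := exist _ f (is_characterP fD fc).

Definition character_eval (chi : character_group R G) x : circle R := val chi x.

Lemma character_ext (chi psi : character_group R G) :
  character_eval chi =1 character_eval psi -> chi = psi.
Proof. by move=> h; apply/val_inj/funext. Qed.

Lemma character_evalD chi psi x :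
  character_eval (chi + psi) x = character_eval chi x + character_eval psi x.
Proof. by []. Qed.

Lemma character_evalB chi psi x :
  character_eval (chi - psi) x = character_eval chi x - character_eval psi x.
Proof. by []. Qed.

End Characters.

Lemma character_pullback (G H : PreTopologicalZmodule.type) (h : G -> H) :
  {morph h : x y / x + y} -> continuous h ->
  exists h' : character_group R H -> character_group R G,
    forall chi x, character_eval (h' chi) x = character_eval chi (h x).
Proof.
move=> hD hc.
suff /choice[h' h'E] (chi : character_group R H) :
    exists psi : character_group R G,
      forall x, character_eval psi x = character_eval chi (h x) by exists h'.
have [chiD chic] := characterP chi.
have psiD : {morph (fun x => character_eval chi (h x)) : x y / x + y}.
  by move=> x y; rewrite hD; exact: chiD.
have psic : continuous (fun x => character_eval chi (h x)).
  by move=> x; apply: (@continuous_comp _ _ _ h); [exact: hc|exact: chic].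
by exists (character psiD psic).
Qed.

Lemma character_group_isomorphic (G H : PreTopologicalZmodule.type) :
  topologically_isomorphic G H ->
  group_isomorphic (character_group R G) (character_group R H).
Proof.
move=> [f [g [fD fK gK fc gc]]].
have gD : {morph g : x y / x + y}.
  by move=> x y; apply: (can_inj fK); rewrite fD !gK.
have [g' g'E] := character_pullback gD gc.
have [f' f'E] := character_pullback fD fc.
have g'D : {morph g' : chi psi / chi + psi}.
  move=> chi psi; apply: character_ext => x.
  by rewrite g'E !character_evalD !g'E.
by exists (additive_of g'D); exists f' => chi; apply: character_ext => x;
  rewrite ?g'E ?f'E ?g'E ?fK ?gK.
Qed.

End CharacterGroup.

(** * Duality between a solenoid and its rational dual *)

Section SolenoidDuality.
Variables (R : realType) (n : nat).

Lemma rational_dual_character_group (N : nat -> 'M[int]_n) :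
  (forall j, \det (N j) != 0) ->
  group_isomorphic (rational_dual N) (character_group R (solenoid R N)).
Proof.
move=> detN.
pose f (a : rational_dual N) : character_group R (solenoid R N) :=
  character (pairingDr a) (@pairing_continuous R n N a).
have fE a x : character_eval (f a) x = pairing a x by [].
have fB : {morph f : a b / a - b}.
  move=> a b; apply: character_ext => x.
  by rewrite character_evalB !fE pairingBl.
have /choice[g fK] chi : exists a, f a = chi.
  have [chiD chic] := characterP chi.
  have [a aE] := character_is_pairing (chi := additive_of chiD) detN chic.
  by exists a; apply: character_ext => x; rewrite fE -aE.
pose fA : {additive rational_dual N -> character_group R (solenoid R N)} :=
  HB.pack f (GRing.isZmodMorphism.Build _ _ f fB).
exists fA; exists g => // a; apply: (@pairing_inj R) => // x.
by rewrite -!fE [f _]fK.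
Qed.

Lemma pairing_dual_basis (N : nat -> 'M[int]_n)
    (detN : forall j, \det (N j) != 0) j k (x : solenoid R N) :
  pairing (dual_basis detN j k) x = val x j k.
Proof.
rewrite (pairingE (a := dual_basis detN j k) _
  (dual_basis_vector_integral detN j k)).
rewrite /coordinate_character (bigD1 k)//= big1 ?addr0 => [|i ik].
  by rewrite mxE !eqxx mulr1z.
by rewrite mxE (negPf ik) andbF mulr0z.
Qed.

Lemma solenoid_point (N : nat -> 'M[int]_n)
    (phi : {additive rational_dual N -> circle R}) :
  (forall j, \det (N j) != 0) ->
  exists x : solenoid R N, forall a, pairing a x = phi a.
Proof.
move=> detN.
pose x : torus_sequences R n := fun j k => phi (dual_basis detN j k).
have xN : x \in solenoid_pred N.
  apply/asboolP => j; apply/funext => i.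
  rewrite /x -dual_basis_bonding raddf_sum; apply: eq_bigr => k _.
  by rewrite raddfMz.
pose x' : solenoid R N := exist _ x xN.
exists x' => a; have /rational_dualP[j [z az]] := valP a.
rewrite (pairingE _ az) [in RHS](dual_basis_decomp detN az) raddf_sum.
by apply: eq_bigr => k _; rewrite raddfMz.
Qed.

Lemma solenoid_separated (N : nat -> 'M[int]_n) (x y : solenoid R N) :
  (forall j, \det (N j) != 0) ->
  (forall a, pairing a x = pairing a y) -> x = y.
Proof.
move=> detN xy; apply: val_inj; apply/funext => j; apply/funext => k.
by rewrite -!(pairing_dual_basis detN) xy.
Qed.

(** A homomorphism of rational duals has a transpose: pairing a point with its
    values is a homomorphism to the circle, so it comes from a point. *)
Lemma rational_dual_pullback (N D : nat -> 'M[int]_n)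
    (theta : {additive rational_dual D -> rational_dual N}) :
  (forall j, \det (D j) != 0) ->
  exists2 f : solenoid R N -> solenoid R D, continuous f &
    forall b x, pairing b (f x) = pairing (theta b) x.
Proof.
move=> detD.
have /choice[f fE] (x : solenoid R N) : exists y : solenoid R D,
    forall b, pairing b y = pairing (theta b) x.
  have phiB : {morph (fun b => pairing (theta b) x) : a b / a - b}.
    by move=> a b; rewrite raddfB pairingBl.
  pose phi : {additive rational_dual D -> circle R} :=
    HB.pack (fun b => pairing (theta b) x)
      (GRing.isZmodMorphism.Build _ _ _ phiB).
  exact: (solenoid_point phi).
exists f => //; apply: continuous_solenoid => j k.
have -> : (fun x => val (f x) j k) = pairing (theta (dual_basis detD j k)).
  by apply/funext => x; rewrite -fE pairing_dual_basis.
exact: pairing_continuous.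
Qed.

Theorem solenoid_isomorphic_of_dual (N D : nat -> 'M[int]_n) :
  (forall j, \det (N j) != 0) -> (forall j, \det (D j) != 0) ->
  group_isomorphic (rational_dual N) (rational_dual D) ->
  topologically_isomorphic (solenoid R N) (solenoid R D).
Proof.
move=> detN detD [theta [eta0 thetaK eta0K]].
have eta0D : {morph eta0 : a b / a + b}.
  by move=> a b; apply: (can_inj thetaK); rewrite raddfD /= !eta0K.
have [f fc fE] := rational_dual_pullback (additive_of eta0D) detD.
have [g gc gE] := rational_dual_pullback theta detN.
exists f, g; split=> // [x y|x|y].
- by apply: solenoid_separated => // b; rewrite pairingDr !fE pairingDr.
- by apply: solenoid_separated => // a; rewrite gE fE /= thetaK.
- by apply: solenoid_separated => // b; rewrite fE gE /= eta0K.
Qed.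

End SolenoidDuality.

(** * Compactness of solenoids and discreteness of their duals *)

(** A cluster point of the image of an ultrafilter is a limit of it, because the
    ultrafilter decides the preimage of every neighbourhood. *)
Lemma compact_ultra_image (S : Type) (T : topologicalType) (f : S -> T)
    (F : set_system S) :
  UltraFilter F -> compact [set: T] -> exists p : T, f @ F --> p.
Proof.
move=> FU /(_ (fmap f F) _ filterT)[p [_ clp]]; exists p => A pA.
have [//|/= FnA] := in_ultra_setVsetC (f @^-1` A) FU.
by have [q [+ Aq]] := clp (~` A) A FnA pA; move=> /(_ Aq).
Qed.

(** Along an ultrafilter all coordinates converge, the circle being compact, and
    the equations of the solenoid pass to the limit. *)
Lemma compact_solenoid (R : realType) (n : nat) (N : nat -> 'M[int]_n) :
  compact [set: solenoid R N].
Proof.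
rewrite compact_ultra => F FU _.
have FP : ProperFilter F by exact: ultra_proper.
have /choice[y yF] (jk : nat * 'I_n) : exists p : circle R,
    val x jk.1 jk.2 @[x --> F] --> p.
  by apply: compact_ultra_image; exact: compact_circle.
pose y' : torus_sequences R n := fun j k => y (j, k).
have Fy' : val x @[x --> F] --> y'.
  by apply: cvg_torus_sequences => j k; exact: (yF (j, k)).
have yN : y' \in solenoid_pred N.
  apply/asboolP => j; apply/funext => i; apply/eqP.
  rewrite -subr_eq0; apply/eqP.
  (* the defect of the bonding equation is continuous and vanishes along [F] *)
  pose c (x : torus_sequences R n) : circle R :=
    x j i - \sum_k x j.+1 k *~ N j i k.
  have c_continuous : continuous c.
    apply: continuous_sub; first exact: torus_sequences_coordinate_continuous.
    apply: continuous_big => [|k _]; first exact: add_continuous.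
    apply: continuous_mulrz; exact: torus_sequences_coordinate_continuous.
  have cF := cvg_comp _ _ Fy' (c_continuous y').
  apply: (closed_cvg _ (@closed_zero R) _ _ cF).
  by near=> x; rewrite /= /c -solenoidE subrr.
pose p : solenoid R N := exist _ y' yN.
exists p; split => //; apply: cvg_solenoid => j k.
exact: (yF (j, k)).
Unshelve. all: by end_near.
Qed.

Section DiscreteDual.
Variables (R : realType) (G : PreTopologicalZmodule.type).

(* Elements of [arc i] and [wide_arc i] differ by less than 2/8 of a turn, which
   is the half-width of the small arc. *)
Let arc (i : nat) : set (circle R) :=
  @circle_proj R @` `[i%:R / 8, i.+1%:R / 8].
Let wide_arc (i : nat) : set (circle R) :=
  @circle_proj R @` `](i%:R - 1) / 8, (i.+1%:R + 1) / 8[.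

Let arc_cover (x : circle R) : exists i : 'I_8, arc i x.
Proof.
have [s /andP[s0 s1] <-] := circle_lift 0 x.
have s8 : 0 <= 8 * s by rewrite mulr_ge0.
have /andP[lo hi] := truncn_itv s8.
have i8 : (Num.truncn (8 * s) < 8)%N.
  by rewrite -(ltr_nat R); apply: le_lt_trans lo _; lra.
by exists (Ordinal i8), s => //=; rewrite in_itv /=; apply/andP; split; lra.
Qed.

Let arc_closed i : closed (arc i).
Proof. by apply: closed_arc; rewrite -[i.+1%:R]natr1; lra. Qed.

Let arc_wide i x : arc i x -> wide_arc i x.
Proof.
move=> [t /= + <-]; rewrite in_itv /= => /andP[lo hi]; exists t => //=.
by rewrite in_itv /=; apply/andP; split; lra.
Qed.

Let arc_close i x y : arc i x -> wide_arc i y -> small_arc (y - x).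
Proof.
move=> [s /= + <-] [t /= + <-]; rewrite !in_itv /= -[i.+1%:R]natr1 => sI tI.
by exists (t - s); [rewrite /= ltr_norml; lra|exact: raddfB].
Qed.

(** Cover the circle by finitely many short closed arcs. The maps sending the
    preimage under [chi] of each arc into a slightly wider one form a
    compact-open neighbourhood of [chi], since these preimages are compact. A
    character in it differs from [chi] by a character with values in the small
    arc, that is, by zero. *)
Lemma character_isolated (chi : character_group R G) :
  compact [set: G] -> nbhs chi [set chi].
Proof.
move=> Gco; have [chiD chic] := characterP chi.
pose W (i : nat) : set {compact-open, G -> circle R} :=
  [set g | g @` (character_eval chi @^-1` arc i) `<=` wide_arc i].
have Wchi : \forall g \near (val chi : {compact-open, G -> circle R}),
    forall i : 'I_8, W i g.
  apply: (@filter_forall _ _ (fun i : 'I_8 => W i) _ (nbhs_filter _)) => i.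
  apply: open_nbhs_nbhs; split.
    apply: compact_open_open; last exact: open_arc.
    apply: (subclosed_compact _ Gco) => //.
    by apply: preimage_closed; [move=> x _; exact: chic|exact: arc_closed].
  by move=> _ [x chix <-]; exact: arc_wide.
have valc :
    continuous (\val : character_group R G -> {compact-open, G -> circle R}).
  exact: initial_continuous.
have : nbhs chi [set psi | forall i : 'I_8, W i (val psi)].
  exact: (valc chi _ Wchi).
apply: (@filterS _ _ (nbhs_filter chi)) => psi psiW.
have small x : small_arc (character_eval (psi - chi) x).
  have [i xi] := arc_cover (character_eval chi x).
  by rewrite character_evalB; apply: (arc_close xi); apply: (psiW i); exists x.
have [dD _] := characterP (psi - chi).
apply/eqP; rewrite -subr_eq0; apply/eqP; apply: character_ext => x.
apply: no_small_subgroup => m.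
have := small (x *+ m).
by rewrite [character_eval _ _](raddfMn (additive_of dD)).
Qed.

Lemma continuous_of_isolated (S T : topologicalType) (f : S -> T) :
  (forall x : S, nbhs x [set x]) -> continuous f.
Proof.
by move=> iso x A /nbhs_singleton Afx; apply: filterS (iso x) => _ ->.
Qed.

Lemma character_group_discrete (A : zmodType) (H : zmodClosed A) :
  compact [set: G] ->
  group_isomorphic (character_group R G) (subgroup H) ->
  topologically_isomorphic (character_group R G) (discrete_group H).
Proof.
move=> Gco [f [g fK gK]]; exists f, g; split => //.
- exact: raddfD.
- by apply: continuous_of_isolated => chi; exact: character_isolated.
- by apply: continuous_of_isolated => h; exact: discrete_set1.
Qed.

End DiscreteDual.

(** * Products of 1-solenoids *)

Section ProductSolenoid.
Variables (R : realType) (n : nat) (M : 'I_n -> nat -> 'M[int]_1).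

Definition diagonal_bonds j : 'M[int]_n := diag_mx (\row_i M i j 0 0).

Lemma det_diagonal_bonds :
  (forall i j, \det (M i j) != 0) -> forall j, \det (diagonal_bonds j) != 0.
Proof.
move=> detM j; rewrite det_diag; apply/prodf_neq0 => i _.
by rewrite mxE -det_mx11.
Qed.

Lemma diagonal_bonding (x : torus R n) j i :
  bonding_map (diagonal_bonds j) x i = x i *~ M i j 0 0.
Proof.
rewrite /bonding_map (bigD1 i)//= big1 ?addr0 => [|k ki].
  by rewrite !mxE eqxx mulr1n.
by rewrite !mxE eq_sym (negPf ki) mulr0n mulr0z.
Qed.

Lemma solenoid_product_isomorphic :
  topologically_isomorphic (solenoid R diagonal_bonds)
    (prod_topology (fun i => solenoid R (M i))).
Proof.
have fP (x : solenoid R diagonal_bonds) i :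
    ((fun j _ => val x j i) : torus_sequences R 1)
      \in solenoid_pred (M i).
  apply/asboolP => j; apply/funext => k.
  have /asboolP/(_ j) xj := valP x.
  transitivity (val x j i) => //.
  by rewrite xj diagonal_bonding /bonding_map big_ord1 ord1.
have gP (x : prod_topology (fun i => solenoid R (M i))) :
    ((fun j i => val (x i) j 0) : torus_sequences R n)
      \in solenoid_pred diagonal_bonds.
  apply/asboolP => j; apply/funext => i; rewrite diagonal_bonding.
  by rewrite solenoidE big_ord1.
pose f x : prod_topology (fun i => solenoid R (M i)) :=
  fun i => exist (fun y => y \in solenoid_pred (M i)) _ (fP x i).
pose g x : solenoid R diagonal_bonds :=
  exist (fun y => y \in solenoid_pred diagonal_bonds) _ (gP x).
have fE x i j k : val (f x i) j k = val x j i by [].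
have gE x j i : val (g x) j i = val (x i) j 0 by [].
exists f, g; split.
- move=> x y; apply: functional_extensionality_dep => i; apply: val_inj.
  apply/funext => j; apply/funext => k.
  by rewrite [LHS]fE [RHS]solenoid_coordinateD [LHS]solenoid_coordinateD.
- by move=> x; apply: val_inj; apply/funext => j; apply/funext => i.
- move=> x; apply: functional_extensionality_dep => i; apply: val_inj.
  by apply/funext => j; apply/funext => k; rewrite fE gE ord1.
- apply: continuous_prod_topology => i; apply: continuous_solenoid => j k.
  exact: (@solenoid_coordinate_continuous R n diagonal_bonds j i).
- apply: continuous_solenoid => j i x.
  apply: (@continuous_comp _ _ _
    (fun x : prod_topology (fun i => solenoid R (M i)) => x i)
    (fun y : solenoid R (M i) => val y j 0)).
    exact: prod_topology_proj_continuous.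
  exact: solenoid_coordinate_continuous.
Qed.

End ProductSolenoid.

(** * Subgroups of the rationals *)

(** The form in which Bezout identities are used below, both in the rationals
    and in the reals. *)
Lemma gcd_multiple_closed (V : zmodType) (H : zmodClosed V) (v : V) m n :
  v *+ m \in H -> v *+ n \in H -> v *+ gcdn m n \in H.
Proof.
have [-> _|m_gt0 vm vn] := posnP m; first by rewrite gcd0n.
have [k l kl _] := egcdnP n m_gt0.
have -> : v *+ gcdn m n = v *+ m *+ k - v *+ n *+ l.
  by rewrite -!mulrnA mulnC kl mulrnDr mulnC addrAC subrr add0r.
by apply: rpredB; exact: rpredMn.
Qed.

(** The rational dual of the 1-solenoid with bonds [m], as a subgroup of the
    rationals: see [rational_dual_diagonal]. *)
Definition bounded_denominator (m : nat -> int) (q : rat) : Prop :=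
  exists j, q * (\prod_(k < j) m k)%:~R \is a Num.int.

Lemma bounded_denominator_le (m : nat -> int) (q : rat) i j : (i <= j)%N ->
  q * (\prod_(k < i) m k)%:~R \is a Num.int ->
  q * (\prod_(k < j) m k)%:~R \is a Num.int.
Proof.
move=> /subnK <-; elim: (j - i)%N => [//|k IHk] qi.
by rewrite big_ord_recr intrM mulrA rpredM ?IHk ?intr_int.
Qed.

Section RationalSubgroup.
Variable H : zmodClosed rat.

Let unit_fraction d : rat := d.+1%:R^-1.

(** The least common multiple of the [d] in [1 .. j] whose reciprocal is in
    [H]. *)
Fixpoint common_denominator j : nat :=
  if j is i.+1 then
    lcmn (common_denominator i) (if unit_fraction i \in H then i.+1 else 1)
  else 1.

Lemma common_denominator_gt0 j : (0 < common_denominator j)%N.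
Proof. by elim: j => //= j IHj; rewrite lcmn_gt0 IHj; case: ifP. Qed.

(** The reciprocal of the least common multiple of [a] and [b] is
    [gcd a b / (a b)], where [1 / (a b)] has its multiples by [a] and by [b] in
    [H]. *)
Lemma common_denominator_in j :
  1 \in H -> (common_denominator j)%:R^-1 \in H.
Proof.
move=> H1; elim: j => [|j IHj]; first by rewrite invr1.
rewrite /=; set a := common_denominator j; set b := (if _ then _ else _).
have a_gt0 : (0 < a)%N := common_denominator_gt0 j.
have bH : b%:R^-1 \in H by rewrite /b; case: ifP => // _; rewrite invr1.
have b_gt0 : (0 < b)%N by rewrite /b; case: ifP.
have a0 : a%:R != 0 :> rat by rewrite pnatr_eq0 -lt0n.
have b0 : b%:R != 0 :> rat by rewrite pnatr_eq0 -lt0n.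
have l0 : (lcmn a b)%:R != 0 :> rat by rewrite pnatr_eq0 -lt0n lcmn_gt0 a_gt0.
have -> : (lcmn a b)%:R^-1 = (a * b)%:R^-1 *+ gcdn b a :> rat.
  apply: (mulfI l0); rewrite mulfV// -[X in _ = _ * X]mulr_natr mulrCA -natrM.
  by rewrite gcdnC muln_lcm_gcd mulVf// natrM mulf_neq0.
apply: gcd_multiple_closed; rewrite -[X in X \in H]mulr_natr natrM invfM.
  by rewrite -mulrA mulVf// mulr1.
by rewrite mulrAC mulVf// mul1r.
Qed.

(** With [q = c / d] in lowest terms, the multiples of [1 / d] by [d] and by [c]
    are in [H]. *)
Lemma unit_fraction_in q : 1 \in H -> q \in H -> `|denq q|%N%:R^-1 \in H.
Proof.
move=> H1 qH; set d := `|denq q|%N; pose c := `|numq q|%N.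
have d0 : d%:R != 0 :> rat by rewrite pnatr_eq0 absz_eq0 denq_eq0.
have -> : d%:R^-1 = d%:R^-1 *+ gcdn d c :> rat.
  by have /eqP := coprime_num_den q; rewrite gcdnC => ->.
apply: gcd_multiple_closed; first by rewrite -[X in X \in H]mulr_natr mulVf.
rewrite -[X in X \in H]mulr_natl /c natr_absz intr_norm.
have qd : (numq q)%:~R = q * d%:R.
  by rewrite numqE /d pmulrn absz_denq.
rewrite qd normrM normr_nat mulfK//.
by have [q0|q0] := lerP 0 q; rewrite ?(ger0_norm q0) ?(ltr0_norm q0) ?rpredN.
Qed.

(** The subgroup [H] is the increasing union of the groups of the multiples of
    [1 / common_denominator j], and the bonds are the successive quotients of
    these denominators. *)
Lemma rational_subgroup_denominators : 1 \in H ->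
  exists m : nat -> int, (forall j, m j != 0) /\
    forall q, q \in H <-> bounded_denominator m q.
Proof.
move=> H1; pose L := common_denominator.
have L_dvd j : (L j %| L j.+1)%N by rewrite dvdn_lcml.
exists (fun j => (L j.+1 %/ L j)%N%:Z); split=> [j|q].
  by rewrite -lt0n divn_gt0 ?common_denominator_gt0// dvdn_leq
    ?common_denominator_gt0.
have prodL j : \prod_(k < j) (L k.+1 %/ L k)%N%:Z = (L j)%:Z.
  elim: j => [|j IHj]; first by rewrite big_ord0.
  by rewrite big_ord_recr /= IHj -PoszM mulnC divnK.
split=> [qH|[j]]; rewrite /bounded_denominator.
  set d := `|denq q|%N; have d_gt0 : (0 < d)%N by rewrite absz_gt0 denq_eq0.
  exists d; rewrite prodL.
  have /dvdnP[k ->] : (d %| L d)%N.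
    rewrite -[d in L d]prednK//= /unit_fraction prednK//.
    by rewrite unit_fraction_in// dvdn_lcmr.
  rewrite mulnC PoszM intrM mulrA /d absz_denq -numqE.
  by rewrite rpredM ?intr_int.
rewrite prodL => /intrP[z qz].
have L0 : (L j)%:R != 0 :> rat.
  by rewrite pnatr_eq0 -lt0n common_denominator_gt0.
have -> : q = (L j)%:R^-1 *~ z by rewrite -mulrzl -qz mulfK.
by rewrite rpredMz// common_denominator_in.
Qed.

End RationalSubgroup.

(** * Diagonal solenoids *)

Lemma partial_product_diagonal n (M : 'I_n -> nat -> 'M[int]_1) j :
  partial_product (diagonal_bonds M) j =
  diag_mx (\row_i \prod_(k < j) M i k 0 0).
Proof.
elim: j => [|j IHj] /=.
  apply/matrixP => i k; rewrite !mxE big_ord0.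
  by case: eqP => // ->; rewrite eqxx.
rewrite IHj mulmx_diag; congr diag_mx; apply/rowP => i.
by rewrite !mxE big_ord_recr.
Qed.

Lemma rational_dual_diagonal n (M : 'I_n -> nat -> 'M[int]_1) (a : 'rV_n) :
  a \in rational_dual_pred (diagonal_bonds M) <->
  forall i, bounded_denominator (fun j => M i j 0 0) (a 0 i).
Proof.
have entry j i : (a *m map_mx intr (partial_product (diagonal_bonds M) j)) 0 i =
    a 0 i * (\prod_(k < j) M i k 0 0)%:~R.
  by rewrite partial_product_diagonal map_diag_mx mul_mx_diag !mxE.
split=> [/rational_dualP[j [z az]] i|/choice[j aj]].
  by exists j; rewrite -entry az mxE intr_int.
apply/rational_dualP; exists (\max_i j i)%N.
exists (\row_i Num.floor (a 0 i * (\prod_(k < \max_i j i) M i k 0 0)%:~R)).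
apply/rowP => i; rewrite entry !mxE floorK//.
apply: (@bounded_denominator_le (fun k => M i k 0 0) _ (j i)) => //.
exact: leq_bigmax.
Qed.

(** * Rational combinations of real numbers *)

Section RationalCombinations.
Variables (R : realType) (n : nat).
Implicit Types (b : 'I_n -> R) (a : 'rV[rat]_n) (G : zmodClosed R).

Definition combination b a : R := \sum_i ratr (a 0 i) * b i.

Lemma combinationB b : {morph combination b : a c / a - c}.
Proof.
move=> a c; rewrite /combination -sumrB; apply: eq_bigr => i _.
by rewrite !mxE rmorphB mulrBl.
Qed.

Lemma combination_delta b q i :
  combination b (q *: delta_mx 0 i) = ratr q * b i.
Proof.
rewrite /combination (bigD1 i)//= big1 ?addr0 => [|k ki].
  by rewrite !mxE !eqxx mulr1.
by rewrite !mxE (negPf ki) andbF mulr0 rmorph0 mul0r.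
Qed.

Definition rationally_independent b := injective (combination b).

Definition combination_image b (A : {pred 'rV[rat]_n}) : {pred R} :=
  [pred g | `[< exists2 a, a \in A & g = combination b a >]].

Lemma combination_imageP b (A : {pred 'rV[rat]_n}) g :
  reflect (exists2 a, a \in A & g = combination b a)
    (g \in combination_image b A).
Proof. exact: asboolP. Qed.

Lemma combination_image_zmod_closed b (A : zmodClosed 'rV[rat]_n) :
  zmod_closed (combination_image b A).
Proof.
split=> [|_ _ /combination_imageP[a aA ->] /combination_imageP[c cA ->]].
  apply/combination_imageP; exists 0; first exact: rpred0.
  by rewrite /combination big1// => i _; rewrite mxE rmorph0 mul0r.
apply/combination_imageP; exists (a - c); first exact: rpredB.
by rewrite combinationB.
Qed.

HB.instance Definition _ b (A : zmodClosed 'rV[rat]_n) :=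
  GRing.isZmodClosed.Build R (combination_image b A)
    (combination_image_zmod_closed b A).

Lemma combination_isomorphic b (A : zmodClosed 'rV[rat]_n) G :
  rationally_independent b -> G =i combination_image b A ->
  group_isomorphic (subgroup A) (subgroup G).
Proof.
move=> b_inj GA.
have fG (a : subgroup A) : combination b (val a) \in G.
  by rewrite GA; apply/combination_imageP; exists (val a) => //; exact: valP.
pose f (a : subgroup A) : subgroup G :=
  exist (fun g => g \in G) _ (fG a).
have fB : {morph f : a c / a - c}.
  by move=> a c; apply: val_inj; exact: combinationB.
have /choice[h fK] (g : subgroup G) : exists c : subgroup A, f c = g.
  have := valP g; rewrite [_ \in _]GA => /combination_imageP[a aA ga].
  by exists (exist (fun c : 'rV_n => c \in A) a aA); apply: val_inj.
pose fA : {additive subgroup A -> subgroup G} :=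
  HB.pack f (GRing.isZmodMorphism.Build _ _ f fB).
exists fA; exists h => // a; apply/val_inj/b_inj.
exact: (congr1 val (fK (f a))).
Qed.

Lemma represents_combination b (q : 'I_n -> rat) g :
  represents b q g <-> g = combination b (\row_i q i).
Proof.
rewrite /represents /combination.
by under [in X in _ <-> X]eq_bigr do rewrite mxE.
Qed.

Lemma independent_Qbasis b G :
  rationally_independent b ->
  (forall g, g \in G -> exists a, g = combination b a) ->
  Qbasis G b.
Proof.
move=> b_inj Gb g /Gb[a ->] _; exists (fun i => a 0 i); split=> // q.
move=> /represents_combination/b_inj aq; apply/funext => i.
by rewrite aq mxE.
Qed.

(** A dependence relation could be added to the representation of [g], which
    would then not be unique. *)
Lemma Qbasis_independent b G g :
  Qbasis G b -> g \in G -> g != 0 -> rationally_independent b.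
Proof.
move=> Gb gG g0 a c ac; have [q [qg q_unique]] := Gb g gG g0.
have := q_unique (fun i => q i + (a - c) 0 i) => /(_ _)/esym qE.
apply/eqP; rewrite -subr_eq0; apply/eqP/rowP => i; rewrite [RHS]mxE.
suff /(congr1 (@^~ i)) /= : (fun i => q i + (a - c) 0 i) = q.
  by move=> /eqP; rewrite -subr_eq0 addrAC subrr add0r => /eqP.
apply: qE; apply/represents_combination.
have -> : \row_i (q i + (a - c) 0 i) = \row_i q i - (c - a).
  by apply/rowP => k; rewrite !mxE opprB.
rewrite !combinationB ac subrr subr0.
by have /represents_combination := qg.
Qed.

End RationalCombinations.

(** A countable set has measure 0, whereas the unit interval has measure 1. *)
Lemma reals_uncountable (R : realType) : ~ countable [set: R].
Proof.
move=> Rc; have : countable (`[0, 1]%classic : set R).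
  by apply: sub_countable Rc; exact: subset_card_le.
move=> /countable_lebesgue_measure0.
rewrite lebesgue_measure_itv /= lte_fin ltr01.
by rewrite oppr0 adde0 => /eqP; rewrite eqe oner_eq0.
Qed.

Lemma countable_combinations (R : realType) n (b : 'I_n -> R) :
  countable (range (combination b)).
Proof. by apply: sub_countable (card_image_le _ _) _; exact: countableP. Qed.

(** The combinations of an independent family are countably many, so some real
    is not among them and can be adjoined to the family. *)
Lemma exists_independent_reals (R : realType) n :
  exists b : 'I_n -> R, rationally_independent b.
Proof.
elim: n => [|n [b b_inj]].
  by exists (fun=> 0) => a c _; apply/rowP => -[].
have [r rb] : exists r, ~ range (combination b) r.
  apply: contrapT => rb; apply: (@reals_uncountable R).
  apply: sub_countable (countable_combinations b); apply: subset_card_le.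
  by move=> r _; apply: contrapT => rnb; apply: rb; exists r.
pose b' (i : 'I_n.+1) := if unlift ord0 i is Some j then b j else r.
exists b' => a c; rewrite /combination !big_ord_recl /b' !unlift_none.
under eq_bigr do rewrite liftK.
under [in RHS]eq_bigr do rewrite liftK.
pose tl (v : 'rV[rat]_n.+1) : 'rV[rat]_n := \row_j v 0 (lift ord0 j).
have tlE (v : 'rV[rat]_n.+1) :
    \sum_i ratr (v 0 (lift ord0 i)) * b i = combination b (tl v).
  by rewrite /combination; apply: eq_bigr => i _; rewrite mxE.
rewrite !tlE => ac.
have ac0 : a 0 ord0 = c 0 ord0.
  apply/eqP; apply: contrapT => /negP ac0; apply: rb.
  exists ((a 0 ord0 - c 0 ord0)^-1 *: (tl c - tl a)) => //.
  have k0 : ratr (a 0 ord0 - c 0 ord0) != 0 :> R by rewrite fmorph_eq0 subr_eq0.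
  apply: (mulfI k0).
  transitivity (combination b (tl c - tl a)).
    rewrite /combination mulr_sumr; apply: eq_bigr => i _.
    rewrite [in LHS]mxE rmorphM fmorphV mulrA [_ * (_ * _)]mulrA.
    by rewrite mulfV// mul1r.
  by rewrite combinationB rmorphB mulrBl /=; move: ac; lra.
apply/rowP => i; case: (unliftP ord0 i) => [j ->|-> //].
by move: ac; rewrite ac0 => /addrI/b_inj/rowP/(_ j); rewrite !mxE.
Qed.

(** * Relatively prime generators *)

Section RelativelyPrimeGenerators.
Variables (R : realType) (n : nat).
Implicit Types (b : 'I_n -> R) (G : zmodClosed R) (S : set R).

Definition coefficients G (x : R) : {pred rat} := [pred q | ratr q * x \in G].

Lemma coefficients_zmod_closed G x : zmod_closed (coefficients G x).
Proof.
split=> [|p q]; rewrite !inE ?rmorph0 ?mul0r ?rpred0// => pG qG.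
by rewrite rmorphB mulrBl rpredB.
Qed.

HB.instance Definition _ G x :=
  GRing.isZmodClosed.Build rat (coefficients G x)
    (coefficients_zmod_closed G x).

(** The [j]-th term of [g] has two multiples in [G] with coprime factors: by its
    denominator, since [b j] is in [G]; and by the product [D] of the other
    denominators, since [D g] is in [G] and its other terms are integral. *)
Lemma relatively_prime_coefficient b G S g (q : 'I_n -> rat) j :
  (forall i, b i \in G) -> relatively_prime S b -> S g -> g \in G ->
  represents b q g -> q j \in coefficients G (b j).
Proof.
move=> bG Srp Sg gG gq; rewrite inE.
pose v k := ratr (q k) * b k; pose d k := `|denq (q k)|%N.
have vd k : v k *+ d k \in G.
  rewrite /v -mulrnAl -mulr_natr.
  have -> : ratr (q k) * (d k)%:R = (numq (q k))%:~R :> R.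
    rewrite /d pmulrn absz_denq -[X in _ * X]ratr_int -rmorphM -numqE.
    exact: ratr_int.
  by rewrite mulrzl rpredMz.
pose D := (\prod_(k < n | k != j) d k)%N.
have vD : v j *+ D \in G.
  have -> : v j *+ D = g *+ D - \sum_(k < n | k != j) v k *+ D.
    by rewrite sumrMnl -mulrnBl gq (bigD1 j)//= addrK.
  rewrite rpredB ?rpredMn// rpred_sum// => k kj.
  by rewrite /D (bigD1 k)//= mulrnA rpredMn.
have := gcd_multiple_closed (vd j) vD.
have := Srp g q Sg gq j; rewrite /= (bigD1 j)//= mulKn => [->//|].
by rewrite absz_gt0 denq_eq0.
Qed.

Lemma relatively_prime_split b G S (A : zmodClosed 'rV[rat]_n) :
  (forall i, b i \in G) -> Qbasis G b -> generates G S ->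
  relatively_prime S b ->
  (forall a : 'rV_n, a \in A <-> forall i, a 0 i \in coefficients G (b i)) ->
  G =i combination_image b A.
Proof.
move=> bG Gb [SG Sgen] Srp AE g; apply/idP/idP; last first.
  move=> /combination_imageP[a /AE aG ->].
  by apply: rpred_sum => i _; exact: aG.
move: g; apply: Sgen => g Sg; have gG := SG g Sg.
have [q gq] : exists q, represents b q g.
  have [->|g0] := eqVneq g 0.
    exists (fun=> 0).
    by rewrite /represents big1// => i _; rewrite rmorph0 mul0r.
  by have [q [gq _]] := Gb g gG g0; exists q.
apply/combination_imageP; exists (\row_i q i).
  apply/AE => i; rewrite mxE.
  exact: (relatively_prime_coefficient i bG Srp Sg gG gq).
by have /represents_combination := gq.
Qed.

(** The generators are the one-term combinations: at most one of their
    denominators differs from 1. *)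
Lemma split_relatively_prime b (A : zmodClosed 'rV[rat]_n) :
  rationally_independent b ->
  (forall i, delta_mx 0 i \in A) ->
  (forall (a : 'rV_n) i, a \in A -> a 0 i *: delta_mx 0 i \in A) ->
  exists S, generates (combination_image b A) S /\ relatively_prime S b.
Proof.
move=> b_inj deltaA maskA.
exists [set g | exists2 a : 'rV_n, a \in A & exists i, g = ratr (a 0 i) * b i].
split; [split|].
- move=> _ [a aA [i ->]]; rewrite -combination_delta.
  apply/combination_imageP.
  by exists (a 0 i *: delta_mx 0 i); first exact: maskA.
- move=> H SH g /combination_imageP[a aA ->].
  by apply: rpred_sum => i _; apply: SH; exists a => //; exists i.
move=> _ q [a aA [i ->]]; rewrite -combination_delta.
move=> /represents_combination/b_inj qE j /=.
have qk k : k != i -> `|denq (q k)|%N = 1%N.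
  move=> ki; have /rowP/(_ k) := qE.
  by rewrite !mxE (negPf ki) andbF mulr0 => <-.
rewrite (bigD1 i)//= big1 => [|k ki]; last exact: qk.
have [->|ji] := eqVneq j i; last by rewrite (qk j ji) gcd1n.
by rewrite muln1 divnn absz_gt0 denq_eq0 gcdn1.
Qed.

End RelativelyPrimeGenerators.

Theorem theorem12 (R : realType) (n : nat) (N : nat -> 'M[int]_n) :
  (1 <= n)%N ->
  (forall j, \det (N j) != 0) ->
  (exists2 M : 'I_n -> nat -> 'M[int]_1,
      forall i j, \det (M i j) != 0 &
      topologically_isomorphic (solenoid R N)
        (prod_topology (fun i : 'I_n => solenoid R (M i))))
  <->
  (exists2 G : zmodClosed R,
      countable [set` G] &
      topologically_isomorphic (character_group R (solenoid R N))
        (discrete_group G) /\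
      exists (b : 'I_n -> R) (S : set R),
        [/\ forall i, b i \in G, Qbasis G b, generates G S &
            relatively_prime S b]).
Proof.
move=> n_gt0 detN; split=> [[M detM NM]|[G _ [NG [b [S [bG Gb GS Srp]]]]]].
  pose A : zmodClosed 'rV[rat]_n := rational_dual_pred (diagonal_bonds M).
  have detD := det_diagonal_bonds detM.
  have [b b_inj] := exists_independent_reals R n.
  have A1 i : delta_mx 0 i \in A.
    apply/rational_dual_diagonal => k; exists 0%N.
    by rewrite big_ord0 mulr1 mxE rpred_nat.
  have Amask (a : 'rV_n) i : a \in A -> a 0 i *: delta_mx 0 i \in A.
    move=> /rational_dual_diagonal aA; apply/rational_dual_diagonal => k.
    rewrite !mxE eqxx /=; case: eqP => [->|_]; first by rewrite mulr1.
    by exists 0%N; rewrite mulr0 mul0r.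
  have [S [GS Srp]] := split_relatively_prime b_inj A1 Amask.
  exists (combination_image b A : zmodClosed R).
    apply: sub_countable (countable_combinations b); apply: subset_card_le.
    by move=> g /combination_imageP[a _ ->]; exists a.
  split.
    apply: character_group_discrete; first exact: compact_solenoid.
    apply: group_isomorphic_trans
      (combination_isomorphic (A := A) b_inj _) => //.
    apply: group_isomorphic_trans
      (group_isomorphic_sym (rational_dual_character_group R detD)).
    apply: character_group_isomorphic.
    apply: topologically_isomorphic_trans NM _.
    exact/topologically_isomorphic_sym/solenoid_product_isomorphic.
  exists b, S; split=> // [i|].
    rewrite -[b i]mul1r -(rmorph1 (@ratr R)) -combination_delta scale1r.
    by apply/combination_imageP; exists (delta_mx 0 i).
  apply: independent_Qbasis => // g /combination_imageP[a _ ->].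
  by exists a.
have NG' : group_isomorphic (rational_dual N) (subgroup G).
  apply: group_isomorphic_trans (rational_dual_character_group R detN) _.
  exact: topologically_isomorphic_group NG.
(* Uniqueness of representations is a property of the nonzero elements of [G];
   the rational dual contains the integer vectors, so that there is one. *)
have [g gG g0] : exists2 g, g \in G & g != 0.
  have [f f_bij] := NG'.
  pose e := dual_basis detN 0 (Ordinal n_gt0).
  exists (val (f e)); first exact: valP.
  apply/eqP => fe0.
  have e0 : e = 0 by apply: (bij_inj f_bij); apply: val_inj; rewrite raddf0.
  have := dual_basis_vector_integral detN 0 (Ordinal n_gt0).
  rewrite /integral_at -[dual_basis_vector _ _ _]/(val e) e0 mul0mx.
  move=> /rowP/(_ (Ordinal n_gt0)); rewrite !mxE !eqxx => /eqP.
  by rewrite eq_sym intr_eq0.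
have b_inj := Qbasis_independent Gb gG g0.
have coef1 i : 1 \in coefficients G (b i) by rewrite inE rmorph1 mul1r.
have /choice[m mP] i : exists m : nat -> int, (forall j, m j != 0) /\
    forall q, q \in coefficients G (b i) <-> bounded_denominator m q.
  exact: (rational_subgroup_denominators (coef1 i)).
pose M i j : 'M[int]_1 := (m i j)%:M.
have detM i j : \det (M i j) != 0 by rewrite det_scalar1 (mP i).1.
have ME i : (fun j => M i j 0 0) = m i by apply/funext => j; rewrite mxE eqxx.
pose A : zmodClosed 'rV[rat]_n := rational_dual_pred (diagonal_bonds M).
have AE (a : 'rV_n) : a \in A <-> forall i, a 0 i \in coefficients G (b i).
  split=> [/rational_dual_diagonal aA i|aG].
    by apply/(mP i).2; rewrite -ME.
  by apply/rational_dual_diagonal => i; rewrite ME; apply/(mP i).2.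
have GA := relatively_prime_split bG Gb GS Srp AE.
exists M => //.
apply: topologically_isomorphic_trans (solenoid_product_isomorphic R M).
apply: solenoid_isomorphic_of_dual => //; first exact: det_diagonal_bonds.
apply: group_isomorphic_trans NG' _.
exact: (group_isomorphic_sym (combination_isomorphic (A := A) b_inj GA)).
Qed.
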